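(* Let $t(n)$ be a sequence of natural numbers, let $\mathrm{GF}_t(z)=\sum_{i=0}^\infty t(i)z^i$ and let $R$ be the radius of convergence of $\mathrm{GF}_t(z)$ at zero. Let $b$ and $n$ be positive integers such that $b\ge 8$, $b^{-1}<R$, and $t(r)<b^{r/3}$ for every integer $r\ge 1$. Then $$t(n)=\left\lfloor b^{n^2}\,\mathrm{GF}_t(b^{-n})\right\rfloor \bmod b^n .$$
   Context: Natural numbers are the non-negative integers. $\mathrm{GF}_t(b^{-n})$ denotes the (real) sum of the power series $\sum_{i\ge 0} t(i) b^{-ni}$. For an integer $y\ge 1$, $x \bmod y$ denotes the least non-negative residue of $x$ modulo $y$. *)

(* Defs.v *)
From Stdlib Require Import Reals ZArith.
From Coquelicot Require Import Coquelicot.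

Open Scope R_scope.

Definition GF_coef (t : nat -> nat) : nat -> R := fun i => INR (t i).

Definition GF (t : nat -> nat) (z : R) : R := PSeries (GF_coef t) z.

(* Possibly [p_infty], e.g. when [t] is eventually zero. *)
Definition GF_radius (t : nat -> nat) : Rbar := CV_radius (GF_coef t).

(* Main.v *)
Require Import Defs.
From Stdlib Require Import Reals ZArith Lra Lia.
From Coquelicot Require Import Coquelicot.

Open Scope R_scope.

(** With [N = b ^ n], the numbers [t 0, t 1, ...] are the digits of [GF t (/ N)]
    in base [N], up to carries. Multiplying by [N ^ n] moves the point to just after
    the digit [t n], and all the earlier digits then contribute multiples of [N].
    With [c] the cube root of [b], the bound [t r < c ^ r] makes [t n] a genuine
    digit, and it makes the part after the point at most [c ^ (n + 1) / (N - c)],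
    which is less than [1] because [N = c ^ (3 n)] and [c >= 2]. *)

(** Holds without summability: [PSeries] returns [0] when the partial sums tend to
    infinity. *)
Lemma PSeries_ge_0 (a : nat -> R) (x : R) :
  (forall k, 0 <= a k) -> 0 <= x -> 0 <= PSeries a x.
Proof.
intros ha hx.
assert (hlim : Rbar_le 0 (Lim_seq (sum_n (fun k => a k * x ^ k)))).
{ rewrite <- (Lim_seq_const 0).
  apply Lim_seq_le_loc; exists 0%nat; intros m _.
  rewrite sum_n_Reals; apply cond_pos_sum; intros k.
  apply Rmult_le_pos; [apply ha | apply pow_le, hx]. }
unfold PSeries, Series.
destruct (Lim_seq _); simpl in *; lra.
Qed.

Lemma PSeries_le_geom (a : nat -> R) (C q x : R) :
  (forall k, 0 <= a k <= C * q ^ k) -> 0 <= q -> 0 <= x -> q * x < 1 ->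
  PSeries a x <= C / (1 - q * x).
Proof.
intros ha hq hx hqx.
assert (habs : Rabs (q * x) < 1).
{ rewrite Rabs_pos_eq; [exact hqx | now apply Rmult_le_pos]. }
unfold Rdiv; rewrite <- (Series_geom _ habs), <- Series_scal_l.
apply Series_le.
- intros k; rewrite Rpow_mult_distr, <- Rmult_assoc.
  assert (hxk : 0 <= x ^ k) by apply pow_le, hx.
  split; [apply Rmult_le_pos | apply Rmult_le_compat_r]; auto; apply ha.
- apply (ex_series_scal_l C (fun k => (q * x) ^ k)), ex_series_geom, habs.
Qed.

Lemma Rpower_INR_div (x y : R) (m : nat) :
  Rpower x (INR m / y) = Rpower x (/ y) ^ m.
Proof.
rewrite <- Rpower_pow by apply exp_pos.
rewrite Rpower_mult; f_equal; unfold Rdiv; ring.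
Qed.

Lemma Rpower_inv_INR_pow (x : R) (m : nat) :
  (0 < m)%nat -> 0 < x -> Rpower x (/ INR m) ^ m = x.
Proof.
intros hm hx.
rewrite <- Rpower_INR_div; unfold Rdiv.
rewrite Rinv_r by now apply not_0_INR, Nat.neq_0_lt_0.
now apply Rpower_1.
Qed.

Lemma le_Rpower_inv_INR (x y : R) (m : nat) :
  (0 < m)%nat -> 0 < x -> x ^ m <= y -> x <= Rpower y (/ INR m).
Proof.
intros hm hx hxy.
assert (hM : 0 < INR m) by now apply lt_0_INR.
replace x with (Rpower (x ^ m) (/ INR m)) at 1.
- apply Rle_Rpower_l; [now apply Rlt_le, Rinv_0_lt_compat |].
  split; [now apply pow_lt | exact hxy].
- rewrite <- Rpower_pow, Rpower_mult, Rinv_r by lra.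
  now apply Rpower_1.
Qed.

Lemma GF_ext (t u : nat -> nat) (z : R) : (forall k, t k = u k) -> GF t z = GF u z.
Proof. intros htu; apply PSeries_ext; intros k; unfold GF_coef; now rewrite htu. Qed.

Lemma GF_decr_1 (t : nat -> nat) (z : R) :
  ex_pseries (GF_coef t) z -> GF t z = INR (t 0%nat) + z * GF (fun k => t (S k)) z.
Proof. exact (PSeries_decr_1 (GF_coef t) z). Qed.

Lemma GF_ge_0 (t : nat -> nat) (z : R) : 0 <= z -> 0 <= GF t z.
Proof. apply PSeries_ge_0; intros k; apply pos_INR. Qed.

Lemma ex_pseries_GF_coef_shift (t : nat -> nat) (n : nat) (z : R) :
  z <> 0 -> ex_pseries (GF_coef t) z -> ex_pseries (GF_coef (fun k => t (n + k)%nat)) z.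
Proof.
intros hz; apply (ex_pseries_decr_n (GF_coef t)).
right; exists (/ z); now apply Rinv_l.
Qed.

Lemma ex_pseries_GF_coef_inv_pow (t : nat -> nat) (b n : nat) :
  (0 < b)%nat -> (0 < n)%nat -> Rbar_lt (/ INR b) (GF_radius t) ->
  ex_pseries (GF_coef t) (/ INR (b ^ n)).
Proof.
intros hb hn hR.
apply CV_radius_inside, Rbar_le_lt_trans with (/ INR b); [| exact hR].
assert (hB : 0 < INR b) by now apply lt_0_INR.
assert (hpow : INR b <= INR (b ^ n)).
{ apply le_INR; rewrite <- (Nat.pow_1_r b) at 1; apply Nat.pow_le_mono_r; lia. }
simpl; rewrite Rabs_pos_eq.
- now apply Rinv_le_contravar.
- apply Rlt_le, Rinv_0_lt_compat; lra.
Qed.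

Lemma Zfloor_pow_mul_GF_mod_shift (t : nat -> nat) (N n : nat) :
  (0 < N)%nat -> ex_pseries (GF_coef t) (/ INR N) ->
  (Zfloor (INR N ^ n * GF t (/ INR N)) mod Z.of_nat N
   = Zfloor (GF (fun k => t (n + k)%nat) (/ INR N)) mod Z.of_nat N)%Z.
Proof.
intros hN.
assert (hN0 : INR N <> 0) by now apply not_0_INR, Nat.neq_0_lt_0.
revert t; induction n as [| n IHn]; intros t ht.
- now rewrite pow_O, Rmult_1_l.
- assert (hstep : INR N ^ S n * GF t (/ INR N)
    = INR N ^ n * GF (fun k => t (S k)) (/ INR N)
      + IZR (Z.of_nat (t 0%nat * N ^ n * N))).
  { rewrite (GF_decr_1 t) by exact ht.
    rewrite <- INR_IZR_INZ, !mult_INR, pow_INR; simpl; field; exact hN0. }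
  rewrite hstep, Zfloor_addz, Nat2Z.inj_mul, Z_mod_plus_full.
  apply IHn, (ex_pseries_GF_coef_shift t 1); [now apply Rinv_neq_0_compat | exact ht].
Qed.

Lemma Zfloor_GF (t : nat -> nat) (z : R) :
  ex_pseries (GF_coef t) z -> 0 <= z -> z * GF (fun k => t (S k)) z < 1 ->
  Zfloor (GF t z) = Z.of_nat (t 0%nat).
Proof.
intros ht hz htail; apply Zfloor_eq.
assert (htail0 : 0 <= z * GF (fun k => t (S k)) z).
{ apply Rmult_le_pos; [exact hz | now apply GF_ge_0]. }
rewrite (GF_decr_1 t z ht), <- INR_IZR_INZ; lra.
Qed.

Lemma Zfloor_pow_mul_GF_mod (t : nat -> nat) (N n : nat) :
  ex_pseries (GF_coef t) (/ INR N) -> (t n < N)%nat ->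
  GF (fun k => t (S n + k)%nat) (/ INR N) < INR N ->
  (Zfloor (INR N ^ n * GF t (/ INR N)) mod Z.of_nat N)%Z = Z.of_nat (t n).
Proof.
intros ht hdigit htail.
assert (hN : 0 < INR N) by (apply lt_0_INR; lia).
assert (hinvN : 0 < / INR N) by now apply Rinv_0_lt_compat.
rewrite Zfloor_pow_mul_GF_mod_shift by (lia || exact ht).
rewrite Zfloor_GF, Nat.add_0_r.
- apply Z.mod_small; lia.
- apply ex_pseries_GF_coef_shift; [lra | exact ht].
- lra.
- rewrite <- (Rinv_l (INR N)) by lra.
  apply Rmult_lt_compat_l; [exact hinvN |].
  rewrite (GF_ext _ (fun k => t (S n + k)%nat)); [exact htail |].
  intros k; f_equal; lia.
Qed.

Lemma GF_shift_inv_lt (t : nat -> nat) (c x : R) (m : nat) :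
  0 < c -> (forall r, (m <= r)%nat -> INR (t r) <= c ^ r) -> c ^ m + c < x ->
  GF (fun k => t (m + k)%nat) (/ x) < x.
Proof.
intros hc ht hx.
assert (hcm : 0 < c ^ m) by now apply pow_lt.
assert (hcx : c * / x < 1) by (apply Rlt_div_l; lra).
apply Rle_lt_trans with (c ^ m / (1 - c * / x)).
- apply PSeries_le_geom; [| lra | apply Rlt_le, Rinv_0_lt_compat; lra | exact hcx].
  intros k; split; [apply pos_INR |].
  rewrite <- pow_add; apply ht; lia.
- apply Rlt_div_l; [lra |].
  replace (x * (1 - c * / x)) with (x - c) by (field; lra); lra.
Qed.

Lemma pow_plus_lt_pow (c : R) (k m : nat) :
  2 <= c -> (1 < k < m)%nat -> c ^ k + c < c ^ m.
Proof.
intros hc hkm.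
assert (hck : c < c ^ k) by (rewrite <- (pow_1 c) at 1; apply Rlt_pow; lra || lia).
apply Rlt_le_trans with (c ^ S k); [simpl; nra |].
apply Rle_pow; lra || lia.
Qed.

Theorem theorem4p2 (t : nat -> nat) (b n : nat)
  (hb0 : (0 < b)%nat) (hn0 : (0 < n)%nat)
  (hb : (8 <= b)%nat)
  (hR : Rbar_lt (Finite (/ INR b)) (GF_radius t))
  (ht : forall r : nat, (1 <= r)%nat -> INR (t r) < Rpower (INR b) (INR r / 3)) :
  Z.of_nat (t n) =
    (Zfloor (INR b ^ (n ^ 2) * GF t (/ (INR b ^ n))) mod Z.of_nat (b ^ n))%Z.
Proof.
assert (hB : 8 <= INR b) by (apply le_INR in hb; simpl in hb; lra).
replace 3 with (INR 3) in ht by (simpl; ring).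
set (c := Rpower (INR b) (/ INR 3)).
assert (hc : 2 <= c) by (apply le_Rpower_inv_INR; [lia | lra | simpl; lra]).
assert (hc3 : c ^ 3 = INR b) by (apply Rpower_inv_INR_pow; [lia | lra]).
assert (htc : forall r, (1 <= r)%nat -> INR (t r) < c ^ r).
{ intros r hr; unfold c; rewrite <- Rpower_INR_div; now apply ht. }
assert (hgap : c ^ S n + c < INR (b ^ n)).
{ rewrite pow_INR, <- hc3, <- pow_mult; apply pow_plus_lt_pow; [exact hc | lia]. }
rewrite Nat.pow_2_r, pow_mult, <- pow_INR; symmetry.
apply Zfloor_pow_mul_GF_mod.
- now apply ex_pseries_GF_coef_inv_pow.
- assert (hcn : c ^ n <= c ^ S n) by (apply Rle_pow; [lra | lia]).
  specialize (htc n hn0); apply INR_lt; lra.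
- apply GF_shift_inv_lt with c; [lra | | exact hgap].
  intros r hr; apply Rlt_le, htc; lia.
Qed.
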